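(* Let $\mathcal{X}$ be a finite set with $|\mathcal{X}|\ge 2$ and let $\mathcal{E}\subset\mathcal{X}^2$ be such that the directed graph $(\mathcal{X},\mathcal{E})$ is strongly connected. Let $M=\{w_\theta:\theta\in\mathbb{R}^d\}\subset\mathcal{W}(\mathcal{X},\mathcal{E})$ be a $d$-dimensional exponential family with $$\log w_\theta(y|x)=C(x,y)+\sum_{i=1}^d\theta^iF_i(x,y)+K_\theta(y)-K_\theta(x)-\psi(\theta)\qquad((x,y)\in\mathcal{E},\ \theta\in\mathbb{R}^d),$$ and let $D:M\times M\to\mathbb{R}$ be its canonical divergence, $$D(w_1\,|\,w_2)=\varphi(w_1)+\psi(w_2)-\sum_{i=1}^d\eta_i(w_1)\,\theta^i(w_2).$$ Then for all $w_1,w_2\in M$, $$D(w_1\,|\,w_2)=\sum_{(x,y)\in\mathcal{E}}p^{(2)}_{w_1}(x,y)\log\frac{w_1(y|x)}{w_2(y|x)}.$$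
   Context: Strongly connected means: for any $(x,y)\in\mathcal{X}^2$ there is a sequence $(x_1,x_2),\ldots,(x_{n-1},x_n)$ in $\mathcal{E}$ with $n\ge2$, $x_1=x$, $x_n=y$. A Markov kernel on $\mathcal{X}$ is a map $w:\mathcal{X}^2\to[0,1]$, $(x,y)\mapsto w(y|x)$, with $\sum_y w(y|x)=1$ for every $x$. $\mathcal{W}(\mathcal{X},\mathcal{E})$ is the set of Markov kernels $w$ with $\{(x,y):w(y|x)>0\}=\mathcal{E}$. Each $w\in\mathcal{W}(\mathcal{X},\mathcal{E})$ is irreducible and so has a unique stationary distribution $p_w$ on $\mathcal{X}$; put $p_w^{(2)}(x,y)=p_w(x)w(y|x)$. A $d$-dimensional exponential family with natural parameter $\theta=(\theta^1,\ldots,\theta^d)$ is a family $\{w_\theta:\theta\in\mathbb{R}^d\}\subset\mathcal{W}(\mathcal{X},\mathcal{E})$, with $\theta\mapsto w_\theta$ injective, for which there exist functions $C,F_1,\ldots,F_d:\mathcal{E}\to\mathbb{R}$, $K:\mathcal{X}\times\mathbb{R}^d\to\mathbb{R}$, $(x,\theta)\mapsto K_\theta(x)$, and $\psi:\mathbb{R}^d\to\mathbb{R}$ satisfying the displayed formula. For $w=w_\theta\in M$: $\theta^i(w)=\theta^i$ and $\psi(w)=\psi(\theta)$; the expectation parameter is $\eta_i(w)=\sum_{(x,y)\in\mathcal{E}}p^{(2)}_{w}(x,y)F_i(x,y)$; and $\varphi(w)=\sum_{i=1}^d\theta^i(w)\eta_i(w)-\psi(w)$. *)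

(* Defs.v *)
From HB Require Import structures.
From mathcomp Require Import all_boot all_order all_algebra.
From mathcomp Require Import all_classical reals exp.

Set Implicit Arguments.
Unset Strict Implicit.
Unset Printing Implicit Defensive.

Import Order.TTheory GRing.Theory Num.Theory.

Local Open Scope classical_set_scope.
Local Open Scope ring_scope.

(* Every walk from x to y is required to use at least one edge, including when
   x = y. *)
Definition strongly_connected (X : finType) (E : {set X * X}) : Prop :=
  forall x y : X, exists s : seq X,
    [/\ s != [::], path (fun u v => (u, v) \in E) x s & last x s = y].

(* Throughout, [w x y] stands for w(y|x): the first argument is the current
   state, the second one is the next state. *)
Definition markov_kernel (R : realType) (X : finType) (w : X -> X -> R) : Prop :=
  (forall x y, 0 <= w x y <= 1) /\ (forall x, \sum_(y : X) w x y = 1).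

Definition kernels_on (R : realType) (X : finType) (E : {set X * X}) :
    set (X -> X -> R) :=
  [set w : X -> X -> R |
    markov_kernel w /\ forall x y, (0 < w x y) = ((x, y) \in E)].

Definition stationary (R : realType) (X : finType) (w : X -> X -> R)
    (p : X -> R) : Prop :=
  [/\ forall x, 0 <= p x, \sum_(x : X) p x = 1
    & forall y, \sum_(x : X) p x * w x y = p y].

(* p_w. An irreducible Markov kernel has exactly one stationary distribution;
   the default value 0 is taken only if there is none. *)
Definition stationary_dist (R : realType) (X : finType) (w : X -> X -> R) :
    X -> R :=
  xget (fun=> 0) [set p : X -> R | stationary w p].

Definition edge_dist (R : realType) (X : finType) (w : X -> X -> R)
    (x y : X) : R :=
  stationary_dist w x * w x y.

(* C and the F i are functions on E, represented by total functions whose values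
   outside E are never used. *)
Definition exponential_family (R : realType) (X : finType) (E : {set X * X})
    (d : nat) (w_ : 'rV[R]_d -> X -> X -> R)
    (C : X -> X -> R) (F : 'I_d -> X -> X -> R)
    (K : 'rV[R]_d -> X -> R) (psi : 'rV[R]_d -> R) : Prop :=
  [/\ range w_ `<=` kernels_on E,
      injective w_
    & forall (theta : 'rV[R]_d) (x y : X), (x, y) \in E ->
        ln (w_ theta x y) =
        C x y + \sum_(i < d) theta 0 i * F i x y + K theta y - K theta x
        - psi theta].

(* theta(w): the unique parameter of w when w belongs to the family [range w_]
   with w_ injective; irrelevant otherwise. *)
Definition natural_param (R : realType) (X : finType) (d : nat)
    (w_ : 'rV[R]_d -> X -> X -> R) (w : X -> X -> R) : 'rV[R]_d :=
  xget 0 [set theta : 'rV[R]_d | w_ theta = w].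

Definition expectation_param (R : realType) (X : finType) (E : {set X * X})
    (d : nat) (F : 'I_d -> X -> X -> R) (w : X -> X -> R) (i : 'I_d) : R :=
  \sum_(e in E) edge_dist w e.1 e.2 * F i e.1 e.2.

Definition potential (R : realType) (X : finType) (d : nat)
    (w_ : 'rV[R]_d -> X -> X -> R) (psi : 'rV[R]_d -> R)
    (w : X -> X -> R) : R :=
  psi (natural_param w_ w).

Definition dual_potential (R : realType) (X : finType) (E : {set X * X})
    (d : nat) (w_ : 'rV[R]_d -> X -> X -> R) (F : 'I_d -> X -> X -> R)
    (psi : 'rV[R]_d -> R) (w : X -> X -> R) : R :=
  \sum_(i < d) natural_param w_ w 0 i * expectation_param E F w i
  - potential w_ psi w.

Definition canonical_divergence (R : realType) (X : finType) (E : {set X * X})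
    (d : nat) (w_ : 'rV[R]_d -> X -> X -> R) (F : 'I_d -> X -> X -> R)
    (psi : 'rV[R]_d -> R) (w1 w2 : X -> X -> R) : R :=
  dual_potential E w_ F psi w1 + potential w_ psi w2
  - \sum_(i < d) expectation_param E F w1 i * natural_param w_ w2 0 i.

(* Main.v *)
Require Import Defs.
From mathcomp Require Import all_boot all_order all_algebra.
From mathcomp Require Import all_classical reals exp.
From mathcomp Require Import ring.

Import Order.TTheory GRing.Theory Num.Theory.

Local Open Scope classical_set_scope.
Local Open Scope ring_scope.

(** Under the stationary edge distribution of [w1], the coboundary
    [K y - K x] has mean zero and constants are preserved, so integrating the
    difference of the two log-densities leaves only the terms in [F] and [psi].
    A stationary distribution exists because [1] is an eigenvalue of a
    stochastic matrix: if [v w = v] then [|v| <= |v| w] entrywise, both sides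
    have the same total mass, hence [|v|] is invariant and can be normalized. *)

Lemma markov_left_eigenvector {R : realType} {X : finType} {w : X -> X -> R} :
  (0 < #|X|)%N -> markov_kernel w ->
  exists v : X -> R,
    (exists x, v x != 0) /\ forall y, \sum_x v x * w x y = v y.
Proof.
move=> X_gt0 [_ w1].
pose A : 'M[R]_#|X| := \matrix_(i, j) w (enum_val i) (enum_val j) - 1%:M.
have detA : \det A == 0.
  (* [det0P] speaks of row vectors. The rows of [w] sum to 1, so the all-ones column lies in the
     kernel of [A]; transposing turns it into the row vector required here. *)
  rewrite -det_tr; apply/det0P; exists (const_mx 1).
    apply/eqP => /rowP/(_ (Ordinal X_gt0)); rewrite !mxE.
    by apply/eqP; rewrite oner_eq0.
  apply/rowP => i; rewrite linearB /= trmx1 mulmxBr mulmx1 !mxE.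
  under eq_bigr do rewrite !mxE mul1r.
  apply/eqP; rewrite subr_eq0 -(w1 (enum_val i)).
  by rewrite [eqbRHS](reindex _ (onW_bij _ (enum_val_bij X))).
have /det0P[v /rV0Pn[i vi] vA] := detA.
exists (fun x => v 0 (enum_rank x)); split.
  by exists (enum_val i); rewrite enum_valK.
move=> y; move: vA; rewrite mulmxBr mulmx1 => /eqP.
rewrite subr_eq0 => /eqP/rowP/(_ (enum_rank y)) <-; rewrite mxE.
rewrite (reindex _ (onW_bij _ (enum_val_bij X))) /=.
by apply: eq_bigr => j _; rewrite mxE enum_valK enum_rankK.
Qed.

Lemma markov_stationary_exists {R : realType} {X : finType} {w : X -> X -> R} :
  (0 < #|X|)%N -> markov_kernel w -> exists p, stationary w p.
Proof.
move=> X_gt0 Mw; have [w01 w1] := Mw.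
have [v [[x0 vx0] vw]] := markov_left_eigenvector X_gt0 Mw.
have le_absv y : `|v y| <= \sum_x `|v x| * w x y.
  rewrite -{1}vw; apply: le_trans (ler_norm_sum _ _ _) _.
  apply: ler_sum => x _; rewrite normrM (ger0_norm (_ : 0 <= w x y)) //.
  by case/andP: (w01 x y).
have absvw y : \sum_x `|v x| * w x y = `|v y|.
  apply/eqP; rewrite -subr_eq0; apply/eqP.
  apply: (@psumr_eq0P _ _ xpredT (fun y => \sum_x `|v x| * w x y - `|v y|)) => //.
    by move=> z _; rewrite subr_ge0.
  rewrite sumrB exchange_big /=.
  by under eq_bigr do rewrite -mulr_sumr w1 mulr1; rewrite subrr.
pose s := \sum_x `|v x|.
have s_gt0 : 0 < s.
  rewrite /s (bigD1 x0) //=; apply: ltr_wpDr; last by rewrite normr_gt0.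
  exact: sumr_ge0.
exists (fun x => `|v x| / s); split.
- by move=> x; rewrite divr_ge0 // ltW.
- by rewrite -mulr_suml divff // gt_eqF.
- by move=> y; under eq_bigr do rewrite mulrAC; rewrite -mulr_suml absvw.
Qed.

(** Existence rules out the default value 0 of [xget]. *)
Lemma stationary_distP {R : realType} {X : finType} {w : X -> X -> R} :
  (0 < #|X|)%N -> markov_kernel w -> stationary w (stationary_dist w).
Proof.
move=> X_gt0 /(markov_stationary_exists X_gt0)[p wp].
by apply: (@xgetPex _ (fun=> 0) [set p | stationary w p]); exists p.
Qed.

(** Off [E] the kernel is nonnegative and not positive, hence zero. The double sum gives access to
    row sums and stationarity. *)
Lemma sum_edge_dist {R : realType} {X : finType} {E : {set X * X}}
    {w : X -> X -> R} (f : X -> X -> R) :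
  kernels_on E w ->
  \sum_(e in E) edge_dist w e.1 e.2 * f e.1 e.2 =
  \sum_x \sum_y edge_dist w x y * f x y.
Proof.
move=> [[w01 _] wE]; rewrite pair_bigA big_mkcond /=.
apply: eq_bigr => -[x y] _ /=; case: ifPn => // xyE.
have /andP[w_ge0 _] := w01 x y; move: xyE.
rewrite -wE lt_neqAle w_ge0 andbT negbK => /eqP wxy.
by rewrite /edge_dist -wxy mulr0 mul0r.
Qed.

Lemma sum_edge_dist_eq1 {R : realType} {X : finType} {E : {set X * X}}
    {w : X -> X -> R} :
  (0 < #|X|)%N -> kernels_on E w -> \sum_(e in E) edge_dist w e.1 e.2 = 1.
Proof.
move=> X_gt0 Ew; have [Mw _] := Ew.
have [_ p1 _] := stationary_distP X_gt0 Mw.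
under eq_bigr do rewrite -[edge_dist _ _ _]mulr1.
rewrite (sum_edge_dist (fun _ _ => 1) Ew) -[RHS]p1.
apply: eq_bigr => x _; under eq_bigr do rewrite mulr1.
by rewrite -mulr_sumr (proj2 Mw) mulr1.
Qed.

(** Both marginals of the edge distribution equal the stationary distribution: the first because
    rows sum to 1, the second by stationarity. So [k] has the same mean at either end of an edge. *)
Lemma sum_edge_dist_coboundary {R : realType} {X : finType} {E : {set X * X}}
    {w : X -> X -> R} (k : X -> R) :
  (0 < #|X|)%N -> kernels_on E w ->
  \sum_(e in E) edge_dist w e.1 e.2 * (k e.2 - k e.1) = 0.
Proof.
move=> X_gt0 Ew; have [Mw _] := Ew.
have [_ _ pw] := stationary_distP X_gt0 Mw.
rewrite (sum_edge_dist (fun x y => k y - k x) Ew).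
under eq_bigr => x _ do
  (under eq_bigr => y _ do rewrite mulrBr; rewrite sumrB -mulr_suml).
rewrite sumrB exchange_big /=; apply/eqP; rewrite subr_eq0; apply/eqP.
apply: eq_bigr => x _; rewrite -mulr_suml; congr (_ * _).
by rewrite [LHS]pw -mulr_sumr (proj2 Mw) mulr1.
Qed.

Lemma natural_paramK {R : realType} {X : finType} {d : nat}
    {w_ : 'rV[R]_d -> X -> X -> R} :
  injective w_ -> cancel w_ (natural_param w_).
Proof.
move=> w_inj theta; apply: w_inj.
by apply: (@xgetPex _ 0 [set t | w_ t = w_ theta]); exists theta.
Qed.

Theorem theorem8 (R : realType) (X : finType) (hX : (2 <= #|X|)%N)
    (E : {set X * X}) (hE : strongly_connected E)
    (d : nat) (w_ : 'rV[R]_d -> X -> X -> R)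
    (C : X -> X -> R) (F : 'I_d -> X -> X -> R)
    (K : 'rV[R]_d -> X -> R) (psi : 'rV[R]_d -> R)
    (hM : exponential_family E w_ C F K psi)
    (w1 w2 : X -> X -> R) (hw1 : range w_ w1) (hw2 : range w_ w2) :
  canonical_divergence E w_ F psi w1 w2 =
  \sum_(e in E) edge_dist w1 e.1 e.2 * ln (w1 e.1 e.2 / w2 e.1 e.2).
Proof.
have [wE w_inj lnw] := hM; have X_gt0 : (0 < #|X|)%N := ltnW hX.
have Ew1 := wE _ hw1; have Ew2 := wE _ hw2.
case: hw1 hw2 Ew1 Ew2 => t1 _ <- [t2 _ <-] Ew1 Ew2.
rewrite /canonical_divergence /dual_potential /potential !natural_paramK //.
pose k x := K t1 x - K t2 x.
(* In the log-ratio [C] cancels. The weight is moved inside the sum over [i] so that exchanging the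
   two sums produces the expectation parameters of [w_ t1]. *)
have -> : \sum_(e in E) edge_dist (w_ t1) e.1 e.2
      * ln (w_ t1 e.1 e.2 / w_ t2 e.1 e.2) =
    \sum_(e in E) (\sum_(i < d) (t1 0 i - t2 0 i)
        * (edge_dist (w_ t1) e.1 e.2 * F i e.1 e.2)
      + edge_dist (w_ t1) e.1 e.2 * (k e.2 - k e.1)
      + edge_dist (w_ t1) e.1 e.2 * (psi t2 - psi t1)).
  apply: eq_bigr => -[x y] xyE /=.
  (* The logarithm splits because both kernels are positive on the common support [E]. *)
  rewrite ln_div ?posrE ?(proj2 Ew1) ?(proj2 Ew2) // !lnw //.
  have -> : \sum_(i < d) (t1 0 i - t2 0 i) * (edge_dist (w_ t1) x y * F i x y)
      = edge_dist (w_ t1) x y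
        * (\sum_(i < d) t1 0 i * F i x y - \sum_(i < d) t2 0 i * F i x y).
    by rewrite -sumrB mulr_sumr; apply: eq_bigr => i _; ring.
  by rewrite /k; ring.
rewrite !big_split /= sum_edge_dist_coboundary // addr0 -mulr_suml.
rewrite sum_edge_dist_eq1 // mul1r exchange_big /=.
under [in RHS]eq_bigr => i _ do rewrite -mulr_sumr mulrBl.
rewrite sumrB /expectation_param.
under [X in _ - X = _]eq_bigr do rewrite mulrC.
ring.
Qed.
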